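(* Let $P$ be an ergodic transition matrix on $D$, reversible with respect to $\pi$, with $\beta_1=\beta>0$, let $\nu$ be a probability distribution on $D$, and let $n\ge1$ be an integer. For a given constant $C$ let the burn-in be $$n_0=\max\left\{\left\lceil\frac{\log(C)}{\log(\beta^{-1})}\right\rceil,0\right\}$$ (read as $n_0=0$ if $C=0$), and let $S_{n,n_0}$ be computed from the Markov chain $X_1,\dots,X_{n+n_0}$ with transition matrix $P$ and initial distribution $\nu$. (i) If $C=\sqrt{\left\|\frac1\pi\right\|_\infty}\sqrt{\left\|\frac\nu\pi-1\right\|_\infty}$, then $$\sup_{\|f\|_2\le1}e_\nu(S_{n,n_0},f)^2\le\frac{2}{n(1-\beta)}+\frac{2}{n^2(1-\beta)^2}.$$ (ii) If $C=16\sqrt2\sqrt{\left\|\frac\nu\pi-1\right\|_\infty}$, then $$\sup_{\|f\|_4\le1}e_\nu(S_{n,n_0},f)^2\le\frac{2}{n(1-\beta)}+\frac{1}{n^2(1-\beta)(1-\sqrt\beta)}.$$ (iii) If $C=2\sqrt{\left\|\frac\nu\pi-1\right\|_\infty}$, then $$\sup_{\|f\|_\infty\le1}e_\nu(S_{n,n_0},f)^2\le\frac{2}{n(1-\beta)}+\frac{2}{n^2(1-\beta)^2}.$$ The suprema are over functions $f\in\mathbb{R}^D$.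
   Context: $D$ is a finite set with $|D|\ge2$, $\pi$ is a probability distribution on $D$, and $P=(p(x,y))_{x,y\in D}$ is a (row-stochastic) transition matrix. $P$ is reversible with respect to $\pi$ if $\pi(x)p(x,y)=\pi(y)p(y,x)$ for all $x,y\in D$. $P$ is ergodic if it is irreducible and aperiodic; then $\pi$ is the unique stationary distribution and $\pi(x)>0$ for all $x$. Put $\|f\|_p^p=\sum_{x\in D}|f(x)|^p\pi(x)$ for $1\le p<\infty$, $\|f\|_\infty=\max_{x\in D}|f(x)|$, and $S(f)=\sum_{x\in D}f(x)\pi(x)$. Here $\frac1\pi$ and $\frac\nu\pi-1$ denote the functions $x\mapsto 1/\pi(x)$ and $x\mapsto \nu(x)/\pi(x)-1$. $P$, acting by $Pf(x)=\sum_{y}p(x,y)f(y)$, is self-adjoint for $\langle f,g\rangle_\pi=\sum_xf(x)g(x)\pi(x)$ and has real eigenvalues $1=\beta_0>\beta_1\ge\beta_2\ge\dots\ge\beta_{|D|-1}>-1$ (with multiplicity). Put $\beta=\max\{\beta_1,|\beta_{|D|-1}|\}<1$. The Markov chain with initial distribution $\nu$ and transition matrix $P$ has law $\nu(x_1)p(x_1,x_2)\cdots p(x_{n+n_0-1},x_{n+n_0})$ on $D^{n+n_0}$; $\mathbf{E}_{\nu,P}$ denotes expectation under this law. Define $S_{n,n_0}(f)=\frac1n\sum_{i=1}^nf(X_{i+n_0})$ and $e_\nu(S_{n,n_0},f)=\left(\mathbf{E}_{\nu,P}|S_{n,n_0}(f)-S(f)|^2\right)^{1/2}$. *)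

(* Defs.v *)
From HB Require Import structures.
From mathcomp Require Import all_boot all_order all_algebra.
From mathcomp Require Import polyrcf.
From mathcomp Require Import all_classical all_reals.
From mathcomp Require Import ereal exp.

Set Implicit Arguments.
Unset Strict Implicit.
Unset Printing Implicit Defensive.

Import Order.TTheory GRing.Theory Num.Theory.
Local Open Scope ring_scope.

Section FiniteMarkovChains.
Variables (R : realType) (D : finType).
Implicit Types (pi nu f : D -> R) (p : D -> D -> R).

Definition is_distribution (mu : D -> R) : Prop :=
  (forall x, 0 <= mu x) /\ \sum_x mu x = 1.

Definition is_transition p : Prop := forall x, is_distribution (p x).

Definition reversible p pi : Prop :=
  forall x y, pi x * p x y = pi y * p y x.

Definition transition_mx p : 'M[R]_#|D| :=
  \matrix_(i, j) p (enum_val i) (enum_val j).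

Definition step_prob p (k : nat) (x y : D) : R :=
  (transition_mx p ^+ k) (enum_rank x) (enum_rank y).

Definition irreducible p : Prop :=
  forall x y, exists k : nat, 0 < step_prob p k x y.

(* The return times of every state have greatest common divisor 1.  Taking
   d = 0 shows that a state without return times is not aperiodic. *)
Definition aperiodic p : Prop :=
  forall (x : D) (d : nat),
    (forall k : nat, (0 < k)%N -> 0 < step_prob p k x x -> (d %| k)%N) ->
    d = 1%N.

Definition ergodic p : Prop := irreducible p /\ aperiodic p.

(* The real eigenvalues in nonincreasing order, each repeated according to its
   algebraic multiplicity. *)
Definition eigenvalues (m : nat) (M : 'M[R]_m) : seq R :=
  sort >=%R
    (flatten [seq nseq (mup x (char_poly M)) x | x <- rootsR (char_poly M)]).

(* beta_k for 0 <= k < #|D|. *)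
Definition eigenval p (k : nat) : R := (eigenvalues (transition_mx p))`_k.

Definition beta p : R :=
  Num.max (eigenval p 1) `|eigenval p #|D|.-1|.

Definition lp_norm pi (q : R) f : R :=
  (\sum_x `|f x| `^ q * pi x) `^ q^-1.

(* The absolute values are nonnegative, so the unit 0 of the iterated maximum
   does not affect its value. *)
Definition sup_norm f : R := \big[Num.max/0]_x `|f x|.

Definition mean pi f : R := \sum_x f x * pi x.

(* nu(x_1) p(x_1, x_2) ... p(x_(N-1), x_N) for w = [:: x_1; ...; x_N]. *)
Definition path_prob p nu (w : seq D) : R :=
  if w is x :: s then nu x * \prod_(t <- pairmap p x s) t else 1.

Definition expectation p nu (N : nat) (F : N.-tuple D -> R) : R :=
  \sum_(w : N.-tuple D) path_prob p nu w * F w.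

(* The entry of w at the zero-based position n0 + i is X_(i + 1 + n0). *)
Definition sample_mean (n n0 : nat) f (w : (n0 + n).-tuple D) : R :=
  n%:R^-1 * \sum_(i < n) f (tnth w (rshift n0 i)).

Definition mc_error p pi nu (n n0 : nat) f : R :=
  Num.sqrt (expectation p nu
    (fun w : (n0 + n).-tuple D =>
       `|sample_mean f w - mean pi f| ^+ 2)).

(* The supremum is taken in the extended reals, where it is the least upper
   bound of any set: bounding it by a real number asserts boundedness. *)
Definition worst_sq_error p pi nu (n n0 : nat) (norm : (D -> R) -> R) : \bar R :=
  ereal_sup
    [set (mc_error p pi nu n n0 f ^+ 2)%:E | f in [set f | norm f <= 1]].

End FiniteMarkovChains.

Definition burn_in (R : realType) (b C : R) : nat :=
  if C == 0 then 0%N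
  else `|Num.max (Num.ceil (ln C / ln b^-1)) 0|%N.

(* Main.v *)
(* Put g = f - S(f) and d = nu/pi - 1.  By reversibility
     E[g(X_j) g(X_k)] = <g, P^m g> + <P^(n0 + a) d, g P^m g>,
   with m = |j - k| and a = min(j, k) - 1.  The spectral theorem gives
   |P^m g|_2 <= beta^m |g|_2 on mean-zero functions, so the first terms sum to
   at most 2n/(1 - beta).  As |d|_2^2 = sum_x d(x) nu(x) <= |d|_oo, the second
   term is controlled by beta^(n0 + a) sqrt(|d|_oo) times a norm of g P^m g, and
   the burn-in absorbs the constants.  In case (ii), |P^m g|_4 is bounded by
   Marcinkiewicz interpolation between L^2 and L^oo. *)
Require Import Defs.
From HB Require Import structures.
From mathcomp Require Import all_boot all_order all_algebra.
From mathcomp Require Import polyrcf complex spectral sesquilinear.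
From mathcomp Require Import all_classical all_reals.
From mathcomp Require Import ereal exp.
From mathcomp Require Import zify ring lra.

Set Implicit Arguments.
Unset Strict Implicit.
Unset Printing Implicit Defensive.

Import Order.TTheory GRing.Theory Num.Theory.
Local Open Scope ring_scope.

(** * Spectral theorem for real symmetric matrices *)

(** The obstacle in the spectral part is that [beta] is read from two positions of a sorted list of
    roots of a characteristic polynomial, while the diagonalisation lives over [R[i]]. The bridge is
    the simplicity of the eigenvalue 1: by the maximum principle real fixed functions are constant,
    hence so are complex ones, and 1 occurs only at the head of the list. The three burn-in
    constants reflect which norm of g P^m g is available. For f in L^2 the product is only in L^1,
    so P^(n0 + a) d has to be bounded uniformly, at the cost of sqrt(|1/pi|_oo). For |f|_oo <= 1 the
    bound |g| <= 2 puts the product in L^2 with norm at most 2 beta^m. For |f|_4 <= 1 interpolation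
    gives |P^k g|_4^2 <= 8 beta^k, so the product has L^2 norm at most 8 beta^(m/2), the origin of
    both 16 = 2 * 8 and sqrt(beta). *)

Lemma char_poly_similar (F : fieldType) n (S A B : 'M[F]_n) :
  S \in unitmx -> S *m A = B *m S -> char_poly A = char_poly B.
Proof.
rewrite unitmxE unitfE => S_unit SA; rewrite /char_poly.
apply: (@mulfI _ (\det (map_mx polyC S))).
  by rewrite det_map_mx polyC_eq0.
rewrite -det_mulmx [RHS]mulrC -det_mulmx; congr (\det _).
rewrite /char_poly_mx mulmxBr mulmxBl -!map_mxM SA.
by rewrite scalar_mxC.
Qed.

Lemma char_poly_diag_mx (F : fieldType) n (d : 'rV[F]_n) :
  char_poly (diag_mx d) = \prod_i ('X - (d 0 i)%:P).
Proof.
rewrite char_poly_trig ?diag_mx_is_trig //.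
by apply: eq_bigr => i _; rewrite mxE eqxx.
Qed.

(** Lets the sorted list be read off a diagonalisation: when the characteristic polynomial splits,
    each value occurs in both lists as often as its multiplicity as a root. *)
Lemma perm_eigenvalues (R : realType) n (M : 'M[R]_n) (s : seq R) :
  char_poly M = \prod_(x <- s) ('X - x%:P) -> perm_eq (eigenvalues M) s.
Proof.
move=> Ms; rewrite /eigenvalues perm_sort.
have M0 : char_poly M != 0 by rewrite monic_neq0 ?char_poly_monic.
apply/allP => x _ /=; apply/eqP; rewrite count_flatten -map_comp.
rewrite -[in RHS]mu_prod_XsubC -Ms.
rewrite (eq_map (g := fun y => (if y == x then mup y (char_poly M) else 0)%N)); last first.
  by move=> y /=; rewrite count_nseq /=; case: eqP => _; rewrite ?mul1n ?mul0n.
have := roots_on_rootsR M0 x; rewrite inE /= => rx.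
rewrite sumnE big_map -big_mkcond /=.
have [xr|xr] := boolP (root (char_poly M) x).
  rewrite -big_filter filter_pred1_uniq ?big_seq1 //.
    by rewrite lt_sorted_uniq ?sorted_roots.
  by rewrite -rx.
rewrite mupNroot // big_seq_cond big1 // => y /andP[yr /eqP yx].
by move: xr; rewrite rx -yx yr.
Qed.

Section RealSpectralTheory.
Local Open Scope complex_scope.
Local Open Scope sesquilinear_scope.

(** Over [R[i]] the matrix is Hermitian, so its spectrum is real: [d] and the factorisation descend
    to [R], while the eigenvectors in [U] remain complex. *)
Lemma symmetric_spectral (R : realType) n (M : 'M[R]_n) : M^T = M ->
  exists (U : 'M[R[i]]_n) (d : 'rV[R]_n),
    [/\ U \is unitarymx,
        U *m map_mx (real_complex R) M = diag_mx (map_mx (real_complex R) d) *m U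
      & char_poly M = \prod_i ('X - (d 0 i)%:P)].
Proof.
move=> Msym; pose Mc := map_mx (real_complex R) M.
have Mherm : Mc \is hermsymmx.
  apply: realsym_hermsym.
    apply/is_hermitianmxP; rewrite expr0 scale1r map_mx_id //.
    by apply/matrixP => i j; rewrite !mxE -[in LHS]Msym mxE.
  by apply/mxOverP => i j; rewrite mxE complex_real.
have sp_real := hermitian_spectral_diag_real Mherm.
have /orthomx_spectralP Mc_eq := hermitian_normalmx Mherm.
have U_unit := spectral_unit Mc.
have UM : spectralmx Mc *m Mc = diag_mx (spectral_diag Mc) *m spectralmx Mc.
  by rewrite {2}Mc_eq !mulmxA mulmxV // mul1mx.
have spE : spectral_diag Mc
    = map_mx (real_complex R) (map_mx (@complex.Re R) (spectral_diag Mc)).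
  by apply/matrixP => i j; rewrite !mxE RRe_real //; apply: (mxOverP sp_real).
exists (spectralmx Mc), (map_mx (@complex.Re R) (spectral_diag Mc)).
split; rewrite -?spE // ?spectral_unitarymx //.
apply: (@map_poly_inj _ _ (real_complex R)).
rewrite map_char_poly (char_poly_similar U_unit UM) char_poly_diag_mx.
rewrite rmorph_prod; apply: eq_bigr => i _.
by rewrite rmorphB /= map_polyX map_polyC /= [in LHS]spE !mxE.
Qed.

Lemma map_Re_mulmx (R : realType) m n q (u : 'M[R[i]]_(m, n)) (M : 'M[R]_(n, q)) :
  map_mx (@complex.Re R) (u *m map_mx (real_complex R) M)
    = map_mx (@complex.Re R) u *m M.
Proof.
apply/matrixP => i j; rewrite !mxE.
rewrite (big_morph (@complex.Re R) (id1 := 0) (op1 := +%R)) //; last by case=> ? ? [].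
by apply: eq_bigr => k _; rewrite !mxE; case: (u i k) => a b /=; rewrite mulr0 subr0.
Qed.

Lemma map_Im_mulmx (R : realType) m n q (u : 'M[R[i]]_(m, n)) (M : 'M[R]_(n, q)) :
  map_mx (@complex.Im R) (u *m map_mx (real_complex R) M)
    = map_mx (@complex.Im R) u *m M.
Proof.
apply/matrixP => i j; rewrite !mxE.
rewrite (big_morph (@complex.Im R) (id1 := 0) (op1 := +%R)) //; last by case=> ? ? [].
by apply: eq_bigr => k _; rewrite !mxE; case: (u i k) => a b /=; rewrite mulr0 add0r.
Qed.

Section SymmetricContraction.
Variables (R : realType) (n : nat) (M : 'M[R]_n) (w : 'rV[R]_n).
Hypothesis Msym : M^T = M.
Hypothesis fixed_line : forall u : 'rV_n, u *m M = u -> exists c, u = c *: w.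
Hypothesis eigen_le1 : forall a, eigenvalue M a -> a <= 1.

(** As [M] is real, the real and imaginary parts of a fixed row are fixed themselves. This transfers
    [fixed_line] to the complex rows of the diagonalising matrix. *)
Lemma complex_fixed_line (u : 'rV[R[i]]_n) :
  u *m map_mx (real_complex R) M = u ->
  exists c, u = c *: map_mx (real_complex R) w.
Proof.
move=> uM.
have [a ua] := fixed_line (etrans (esym (map_Re_mulmx u M)) (congr1 _ uM)).
have [b ub] := fixed_line (etrans (esym (map_Im_mulmx u M)) (congr1 _ uM)).
exists (a +i* b); apply/rowP => j.
move/rowP/(_ j): ua; move/rowP/(_ j): ub; rewrite !mxE.
case: (u 0 j) => x y /= -> ->; apply/eqP.
by rewrite eq_complex /= !mulr0 subr0 add0r !eqxx.
Qed.

Lemma sqr_normE m (v : 'rV[R]_m) :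
  (map_mx (real_complex R) v *m (map_mx (real_complex R) v) ^t*) 0 0
    = (\sum_j v 0 j ^+ 2)%:C.
Proof.
rewrite !mxE rmorph_sum; apply: eq_bigr => j _.
by rewrite !mxE expr2 rmorphM /= conj_Creal ?complex_real.
Qed.

Let eigen_exists s : char_poly M = \prod_(x <- s) ('X - x%:P) ->
  forall x, x \in s -> x <= 1.
Proof.
move=> Ms x xs; apply: eigen_le1; rewrite eigenvalue_root_char Ms.
by rewrite root_prod_XsubC.
Qed.

(** Otherwise two distinct rows of the unitary matrix would have eigenvalue 1, hence both be
    multiples of [w], which contradicts orthonormality. *)
Lemma eigenvalues1_lt1 : (1 < n)%N -> (eigenvalues M)`_1 < 1.
Proof.
move=> n_gt1; have [U [d [Uu UM Md]]] := symmetric_spectral Msym.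
have Md' : char_poly M = \prod_(x <- [seq d 0 i | i <- enum 'I_n]) ('X - x%:P).
  by rewrite big_map big_enum.
have pe := perm_eigenvalues Md'.
have ssort : sorted >=%R (eigenvalues M) by apply: sort_sorted => x y; exact: ge_total.
rewrite ltNge; apply/negP => s1.
have : (1 < count (>= 1%R) (eigenvalues M))%N.
  have : size (eigenvalues M) = n by rewrite (perm_size pe) size_map size_enum_ord.
  case: (eigenvalues M) ssort s1 => [|x [|y t]] /=;
    try by move=> _ _ nE; rewrite -nE in n_gt1.
  move=> /andP[yx _] y1 _; rewrite y1 (le_trans y1 yx) //.
have /permP/(_ (>= 1%R)) -> := pe.
rewrite count_map -size_filter.
have -> : size [seq x <- enum 'I_n | preim (d 0) (>= 1%R) x] = #|[pred i | 1 <= d 0 i]|.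
  rewrite cardE /enum_mem -filter_predI /=; congr size.
  by apply: eq_filter => i; rewrite !inE andbT.
case/card_gt1P => i [j [iP jP ij]].
have fx k : 1 <= d 0 k -> exists c, row k U = c *: map_mx (real_complex R) w.
  move=> dk; apply: complex_fixed_line.
  have d1 : d 0 k = 1.
    apply/eqP; rewrite eq_le dk andbT; apply: (eigen_exists Md').
    by apply: map_f; rewrite mem_enum.
  by rewrite -row_mul UM; apply/rowP => l; rewrite mul_diag_mx !mxE d1 mul1r.
have [a ea] := fx i iP; have [c ec] := fx j jP.
have dot k l : (row k U *m (row l U)^t*) 0 0 = (k == l)%:R.
  move/unitarymxP: Uu => /matrixP/(_ k l); rewrite !mxE => <-.
  by apply: eq_bigr => h _; rewrite !mxE.
have dotZ k l (x y : R[i]) : row k U = x *: map_mx (real_complex R) w ->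
    row l U = y *: map_mx (real_complex R) w ->
    x * (y^* * (\sum_j w 0 j ^+ 2)%:C) = (k == l)%:R.
  move=> kx ly; rewrite -dot kx ly linearZ /= map_mxZ -scalemxAl -scalemxAr.
  by rewrite !mxE; congr (_ * (_ * _)); rewrite -sqr_normE mxE.
have := dotZ i j _ _ ea ec; rewrite (negPf ij) => /eqP.
(* Whichever factor of the inner product of rows [i] and [j] vanishes, it also annihilates the
   squared norm of one of these rows, which is 1. *)
rewrite !mulf_eq0 => /or3P[/eqP z|/eqP z|/eqP z].
- by have /eqP := dotZ i i _ _ ea ea; rewrite eqxx z mul0r eq_sym oner_eq0.
- by have /eqP := dotZ j j _ _ ec ec; rewrite eqxx z mul0r mulr0 eq_sym oner_eq0.
- by have /eqP := dotZ i i _ _ ea ea; rewrite eqxx z !mulr0 eq_sym oner_eq0.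
Qed.

(** In the unitary eigenbasis the rows of eigenvalue 1 are multiples of [w], so [v] has no component
    along them; every other component is scaled by at most [b] in modulus, and Parseval adds them
    up. *)
Lemma symmetric_contraction (v : 'rV[R]_n) :
  w *m M = w -> w != 0 -> v *m w^T = 0 ->
  \sum_j (v *m M) 0 j ^+ 2
    <= Num.max (eigenvalues M)`_1 `|(eigenvalues M)`_n.-1| ^+ 2
       * \sum_j v 0 j ^+ 2.
Proof.
move=> wM w0 vw; set b := Num.max _ _.
have [U [d [Uu UM Md]]] := symmetric_spectral Msym.
have Md' : char_poly M = \prod_(x <- [seq d 0 i | i <- enum 'I_n]) ('X - x%:P).
  by rewrite big_map big_enum.
have pe := perm_eigenvalues Md'.
have ssort : sorted >=%R (eigenvalues M) by apply: sort_sorted => x y; exact: ge_total.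
have ssize : size (eigenvalues M) = n by rewrite (perm_size pe) size_map size_enum_ord.
have one_in : 1 \in eigenvalues M.
  rewrite (perm_mem pe) -root_prod_XsubC -Md' -eigenvalue_root_char.
  by apply/eigenvalueP; exists w; rewrite ?scale1r.
have eig_nth k : (k < n)%N -> (eigenvalues M)`_n.-1 <= (eigenvalues M)`_k.
  move=> kn; apply: (sorted_leq_nth ge_trans ge_refl) => //;
    by rewrite ?inE ?ssize //; lia.
have le_b i : d 0 i != 1 -> `|d 0 i| <= b.
  move=> di1; have di : d 0 i \in eigenvalues M.
    by rewrite (perm_mem pe) map_f // mem_enum.
  have di_lt1 : d 0 i < 1.
    by rewrite lt_neqAle di1 (eigen_exists Md') // map_f // mem_enum.
  move: (di); rewrite -index_mem ssize => kn.
  move: (one_in); rewrite -index_mem ssize => ln.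
  have := nth_index 0 di; set k := index _ _ in kn * => kE.
  have := nth_index 0 one_in; set l := index _ _ in ln * => lE.
  (* An eigenvalue below 1 comes after an occurrence of 1 in the nonincreasing list, so its index is
     at least 1 and entry 1 bounds it from above; the last entry bounds it from below. *)
  have lk : (l < k)%N.
    rewrite ltnNge; apply/negP => kl; suff : 1 <= d 0 i by rewrite leNgt di_lt1.
    by rewrite -lE -kE; apply: (sorted_leq_nth ge_trans ge_refl) => //;
      rewrite ?inE ?ssize.
  rewrite ler_norml !le_max; apply/andP; split; last first.
    rewrite -kE; apply/orP; left; apply: (sorted_leq_nth ge_trans ge_refl) => //;
      by rewrite ?inE ?ssize //; lia.
  have hb : `|(eigenvalues M)`_n.-1| <= b by rewrite le_max lexx orbT.
  have hn : - (eigenvalues M)`_n.-1 <= `|(eigenvalues M)`_n.-1|.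
    by rewrite -normrN ler_norm.
  by have := eig_nth _ kn; rewrite kE; lra.
have UtU : U^t* *m U = 1%:M.
  by have := Uu; rewrite -trmxC_unitary => /unitarymxP; rewrite trmxCK.
have parseval (x : 'rV[R]_n) : (\sum_j x 0 j ^+ 2)%:C
    = \sum_i `|(map_mx (real_complex R) x *m U^t*) 0 i| ^+ 2.
  rewrite -sqr_normE; set X := map_mx _ x.
  have -> : X *m X^t* = (X *m U^t*) *m (X *m U^t*)^t*.
    by rewrite trmx_mul map_mxM trmxCK mulmxA -[X *m _ *m U]mulmxA UtU mulmx1.
  rewrite mxE.
  by apply: eq_bigr => i _; rewrite normCK !mxE.
have MU : map_mx (real_complex R) M *m U^t*
    = U^t* *m diag_mx (map_mx (real_complex R) d).
  rewrite -[LHS]mul1mx -UtU -[X in X = _]mulmxA [U *m _]mulmxA UM -!mulmxA.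
  by move/unitarymxP: Uu => ->; rewrite mulmx1.
rewrite -lecR parseval rmorphM /= parseval mulr_sumr; apply: ler_sum => i _.
rewrite map_mxM -mulmxA MU mulmxA mul_mx_diag !mxE normrM exprMn mulrC.
have [di|di] := eqVneq (d 0 i) 1; last first.
  rewrite ler_wpM2r ?exprn_ge0 // -[X in X ^+ 2]/(`|(d 0 i)%:C|).
  rewrite normc_def /= expr0n addr0 sqrtr_sqr -rmorphXn lecR.
  by rewrite lerXn2r ?nnegrE // ?(le_trans _ (le_b i di)).
suff -> : \sum_j map_mx (real_complex R) v 0 j * (U^t*) j i = 0.
  by rewrite normr0 expr0n !mulr0.
have [a ea] : exists c, row i U = c *: map_mx (real_complex R) w.
  apply: complex_fixed_line.
  by rewrite -row_mul UM; apply/rowP => l; rewrite mul_diag_mx !mxE di mul1r.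
transitivity ((a^*) * ((v *m w^T) 0 0)%:C); last by rewrite vw mxE mulr0.
rewrite mxE rmorph_sum mulr_sumr; apply: eq_bigr => j _.
move/rowP/(_ j): ea; rewrite !mxE => ->.
rewrite !rmorphM /= [X in _ * (_ * X) = _]conj_Creal ?complex_real //.
by rewrite mulrCA.
Qed.



End SymmetricContraction.

End RealSpectralTheory.

(** * Spectral gap of reversible chains *)

Definition markov_op (R : realType) (D : finType) (p : D -> D -> R) (f : D -> R) : D -> R :=
  fun x => \sum_y p x y * f y.

Definition dot_pi (R : realType) (D : finType) (pi f g : D -> R) : R :=
  \sum_x f x * g x * pi x.

Section ReversibleChains.
Variables (R : realType) (D : finType) (p : D -> D -> R) (pi : D -> R).
Hypothesis p_trans : is_transition p.
Implicit Types (f g h : D -> R).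

Let p_ge0 x y : 0 <= p x y. Proof. by have [] := p_trans x. Qed.
Let p_sum1 x : \sum_y p x y = 1. Proof. by have [] := p_trans x. Qed.

Lemma iter_markov_opE k f x :
  iter k (markov_op p) f x = \sum_y step_prob p k x y * f y.
Proof.
elim: k x => [|k IH] x; rewrite ?iterS.
  rewrite (bigD1 x) //= big1 ?addr0 => [|y yx].
    by rewrite /step_prob expr0 mxE eqxx mul1r.
  by rewrite /step_prob expr0 mxE (inj_eq enum_rank_inj) eq_sym (negPf yx) mul0r.
under [LHS]eq_bigr => y _ do rewrite IH mulr_sumr.
rewrite exchange_big; apply: eq_bigr => y _.
rewrite /step_prob exprS mxE mulr_suml.
rewrite [RHS](reindex (@enum_rank D)) /=; last exact/onW_bij/enum_rank_bij.
by apply: eq_bigr => z _; rewrite mxE !enum_rankK mulrA.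
Qed.

Lemma step_prob_ge0 k x y : 0 <= step_prob p k x y.
Proof.
suff H i j : 0 <= (transition_mx p ^+ k) i j by exact: H.
elim: k i j => [|k IH] i j; first by rewrite expr0 mxE ler0n.
by rewrite exprS mxE sumr_ge0 // => l _; rewrite mulr_ge0 // mxE.
Qed.

Lemma markov_op_cst c x : markov_op p (fun=> c) x = c.
Proof. by rewrite /markov_op -mulr_suml p_sum1 mul1r. Qed.

Lemma iter_markov_op_cst k c x : iter k (markov_op p) (fun=> c) x = c.
Proof.
elim: k x => //= k IH x; rewrite -[RHS](markov_op_cst c x).
by apply: eq_bigr => y _; rewrite IH.
Qed.

Lemma step_prob_sum1 k x : \sum_y step_prob p k x y = 1.
Proof.
rewrite -[RHS](iter_markov_op_cst k 1 x) iter_markov_opE.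
by apply: eq_bigr => y _; rewrite mulr1.
Qed.

Lemma markov_op_norm_le f c : (forall x, `|f x| <= c) ->
  forall x, `|markov_op p f x| <= c.
Proof.
move=> fc x; apply: le_trans (ler_norm_sum _ _ _) _.
rewrite -[leRHS](markov_op_cst c x); apply: ler_sum => y _.
by rewrite normrM (ger0_norm (p_ge0 _ _)) ler_wpM2l.
Qed.

Lemma iter_markov_op_norm_le k f c : (forall x, `|f x| <= c) ->
  forall x, `|iter k (markov_op p) f x| <= c.
Proof. by move=> fc; elim: k => //= k IH; apply: markov_op_norm_le. Qed.

Hypothesis p_irr : irreducible p.

(* Maximum principle: at a maximum of [f], the averages [f = P^k f] force
   equality at every state reachable in [k] steps. *)
Lemma harmonic_cst f : (forall x, markov_op p f x = f x) ->
  forall x y, f x = f y.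
Proof.
move=> fP x0 y0; have fPk k x : iter k (markov_op p) f x = f x.
  elim: k x => //= k IH x; rewrite -[RHS]fP.
  by apply: eq_bigr => y _; rewrite IH.
have [/= m _ mP] := @arg_maxP _ R D x0 xpredT f isT.
suff H y : f y = f m by rewrite !H.
have [k kP] := p_irr m y; apply/eqP; rewrite eq_sym -subr_eq0.
have /eqP : \sum_z step_prob p k m z * (f m - f z) = 0.
  under eq_bigr do rewrite mulrBr.
  by rewrite sumrB -mulr_suml step_prob_sum1 -iter_markov_opE fPk mul1r subrr.
rewrite psumr_eq0 => [/allP/(_ y)|z _]; last first.
  by rewrite mulr_ge0 ?step_prob_ge0 // subr_ge0 mP.
by rewrite mem_index_enum => /(_ isT); rewrite mulf_eq0 gt_eqF.
Qed.

(** Evaluate at a state where the modulus of [f] is largest: averaging cannot increase it. *)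
Lemma markov_op_eigen_le1 f a x0 : f x0 != 0 ->
  (forall x, markov_op p f x = a * f x) -> a <= 1.
Proof.
move=> fx0 fa; have [/= m _ mP] := @arg_maxP _ R D x0 xpredT (fun x => `|f x|) isT.
have fm_gt0 : 0 < `|f m| by rewrite (lt_le_trans _ (mP x0 isT)) // normr_gt0.
have := @markov_op_norm_le f `|f m| (fun x => mP x isT) m.
rewrite fa normrM ger_pMl // => ?; by apply: le_trans (ler_norm _) _.
Qed.

Hypothesis pi_distr : is_distribution pi.
Hypothesis p_rev : reversible p pi.

Let pi_ge0 x : 0 <= pi x. Proof. by have [] := pi_distr. Qed.
Let pi_sum1 : \sum_x pi x = 1. Proof. by have [] := pi_distr. Qed.

Lemma dot_pi_markov_op f g :
  dot_pi pi (markov_op p f) g = dot_pi pi f (markov_op p g).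
Proof.
rewrite /dot_pi /markov_op.
under eq_bigr do rewrite !mulr_suml; rewrite exchange_big.
apply: eq_bigr => y _; rewrite mulr_sumr mulr_suml; apply: eq_bigr => x _.
have -> : p x y * f y * g x * pi x = pi x * p x y * (f y * g x) by ring.
by rewrite p_rev; ring.
Qed.

Lemma dot_pi_iter_markov_op k f g :
  dot_pi pi (iter k (markov_op p) f) g = dot_pi pi f (iter k (markov_op p) g).
Proof. by elim: k f g => //= k IH f g; rewrite dot_pi_markov_op IH -iterSr. Qed.

Lemma mean_iter_markov_op k f : mean pi (iter k (markov_op p) f) = mean pi f.
Proof.
have mE g : mean pi g = dot_pi pi (fun=> 1) g by apply: eq_bigr => x _; rewrite mul1r.
rewrite !mE -dot_pi_iter_markov_op.
by apply: eq_bigr => x _; rewrite iter_markov_op_cst.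
Qed.

(** Some state [y] carries mass, and by stationarity the mass of [x] is at least that of [y] times
    the positive probability of going from [y] to [x] in [k] steps. *)
Lemma stationary_gt0 x : 0 < pi x.
Proof.
have [y piy] : exists y, 0 < pi y.
  apply/existsP/contraT; rewrite negb_exists => /forallP /= H.
  have : \sum_y pi y <= 0 by apply: sumr_le0 => y _; rewrite leNgt H.
  by rewrite pi_sum1 ler10.
have [k kP] := p_irr y x.
pose dx z : R := (z == x)%:R.
have -> : pi x = mean pi dx.
  rewrite /mean (bigD1 x) //= big1 ?addr0 /dx ?eqxx ?mul1r // => z zx.
  by rewrite (negPf zx) mul0r.
rewrite -(mean_iter_markov_op k) /mean (bigD1 y) //=.
have it_ge0 z : 0 <= iter k (markov_op p) dx z.
  by rewrite iter_markov_opE sumr_ge0 // => t _; rewrite mulr_ge0 ?step_prob_ge0 ?ler0n.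
rewrite ltr_pwDl ?sumr_ge0 // => [|z _]; last by rewrite mulr_ge0.
rewrite mulr_gt0 // iter_markov_opE (bigD1 x) //= /dx eqxx mulr1.
by rewrite ltr_pwDl ?sumr_ge0 // => z _; rewrite mulr_ge0 ?step_prob_ge0 ?ler0n.
Qed.

(** The conjugate of the transition matrix by the diagonal matrix of square roots of [pi].
    Reversibility makes it symmetric, similarity preserves the eigenvalue list, and [row_of] below
    is the isometry from L^2(pi) to row vectors that turns [markov_op] into multiplication by it. *)
Let sym_mx : 'M[R]_#|D| := \matrix_(i, j)
  (Num.sqrt (pi (enum_val i)) * p (enum_val i) (enum_val j)
     / Num.sqrt (pi (enum_val j))).
Let sqrt_pi : 'rV[R]_#|D| := \row_i Num.sqrt (pi (enum_val i)).

Let sq_gt0 x : 0 < Num.sqrt (pi x). Proof. by rewrite sqrtr_gt0 stationary_gt0. Qed.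
Let sqK x : Num.sqrt (pi x) * Num.sqrt (pi x) = pi x.
Proof. by rewrite -expr2 sqr_sqrtr. Qed.

Let sym_mxT : sym_mx^T = sym_mx.
Proof.
apply/matrixP => i j; rewrite !mxE.
apply: (mulIf (lt0r_neq0 (sq_gt0 (enum_val i)))).
apply: (mulIf (lt0r_neq0 (sq_gt0 (enum_val j)))).
rewrite mulfVK ?gt_eqF //.
rewrite [RHS]mulrAC mulfVK ?gt_eqF //.
by rewrite mulrAC sqK [RHS]mulrAC sqK p_rev.
Qed.

Let char_poly_sym : char_poly sym_mx = char_poly (transition_mx p).
Proof.
symmetry; apply: (@char_poly_similar _ _ (diag_mx sqrt_pi)).
  rewrite unitmxE unitfE det_diag; apply/prodf_neq0 => i _.
  by rewrite mxE gt_eqF.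
apply/matrixP => i j; rewrite mul_diag_mx mul_mx_diag !mxE.
by rewrite mulfVK // gt_eqF.
Qed.

Let eigenvalues_sym : eigenvalues sym_mx = eigenvalues (transition_mx p).
Proof. by rewrite /eigenvalues char_poly_sym. Qed.

Let row_of f : 'rV[R]_#|D| := \row_i (f (enum_val i) * Num.sqrt (pi (enum_val i))).

Let sum_enum (F : D -> R) : \sum_(i < #|D|) F (enum_val i) = \sum_x F x.
Proof. by rewrite [RHS](reindex (@enum_val D D)) //=; exact/onW_bij/enum_val_bij. Qed.

Let row_of_mul f : row_of f *m sym_mx = row_of (markov_op p f).
Proof.
apply/rowP => j; rewrite -[sym_mx]sym_mxT !mxE mulr_suml.
rewrite -[RHS]sum_enum; apply: eq_bigr => i _; rewrite !mxE.
by field; rewrite gt_eqF.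
Qed.

Let row_of_surj u : exists f, u = row_of f.
Proof.
exists (fun x => u 0 (enum_rank x) / Num.sqrt (pi x)); apply/rowP => i.
by rewrite mxE enum_valK mulfVK ?gt_eqF.
Qed.

Let row_of_inj f g : row_of f = row_of g -> forall x, f x = g x.
Proof.
move=> /rowP e x; have := e (enum_rank x); rewrite !mxE enum_rankK.
by apply: mulIf; rewrite gt_eqF.
Qed.

Let row_of_norm f : \sum_j (row_of f) 0 j ^+ 2 = dot_pi pi f f.
Proof.
rewrite /dot_pi -[RHS]sum_enum; apply: eq_bigr => i _.
by rewrite mxE -[in RHS]sqK; ring.
Qed.

Let sym_fixed_line u : u *m sym_mx = u -> exists c, u = c *: row_of (fun=> 1).
Proof.
have [f ->] := row_of_surj u; rewrite row_of_mul => /row_of_inj hf.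
have [x0 _|D0] := pickP (@predT D).
  exists (f x0); apply/rowP => i; rewrite !mxE mul1r.
  by rewrite (harmonic_cst hf _ x0).
by exists 0; apply/rowP => i; have := D0 (enum_val i).
Qed.

Let sym_eigen_le1 a : eigenvalue sym_mx a -> a <= 1.
Proof.
move=> /eigenvalueP[u]; have [f ->] := row_of_surj u; rewrite row_of_mul => fa f0.
have [x fx] : exists x, f x != 0.
  apply/existsP/contraT; rewrite negb_exists => /forallP /= H.
  case/eqP: f0; apply/rowP => i; rewrite !mxE.
  by have := H (enum_val i); rewrite negbK => /eqP ->; rewrite mul0r.
apply: (markov_op_eigen_le1 fx); apply: row_of_inj; rewrite fa.
by apply/rowP => i; rewrite !mxE mulrA.
Qed.

Lemma eigenval1_lt1 : (1 < #|D|)%N -> eigenval p 1 < 1.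
Proof.
by rewrite /eigenval -eigenvalues_sym; exact: eigenvalues1_lt1 sym_fixed_line sym_eigen_le1.
Qed.

Lemma markov_op_contraction f : mean pi f = 0 ->
  dot_pi pi (markov_op p f) (markov_op p f) <= beta p ^+ 2 * dot_pi pi f f.
Proof.
move=> f0; rewrite -!row_of_norm -row_of_mul /beta /eigenval -eigenvalues_sym.
apply: (symmetric_contraction sym_mxT sym_fixed_line sym_eigen_le1).
- by rewrite row_of_mul; apply/rowP => i; rewrite !mxE markov_op_cst.
- have [x _] : exists x, pi x != 0.
    apply/existsP/contraT; rewrite negb_exists => /forallP /= H.
    have : \sum_x pi x = 0 by apply: big1 => x _; apply/eqP; rewrite -[_ == _]negbK H.
    by move/eqP; rewrite pi_sum1 oner_eq0.
  apply/eqP => /rowP/(_ (enum_rank x)); rewrite !mxE mul1r => /eqP.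
  by rewrite gt_eqF.
- apply/matrixP => i j; rewrite !mxE !ord1 -[RHS]f0 /mean -[RHS]sum_enum.
  by apply: eq_bigr => k _; rewrite !mxE mul1r -mulrA sqK.
Qed.

Lemma iter_markov_op_contraction k f : mean pi f = 0 ->
  dot_pi pi (iter k (markov_op p) f) (iter k (markov_op p) f)
    <= (beta p ^+ k) ^+ 2 * dot_pi pi f f.
Proof.
move=> f0; elim: k => [|k IH]; first by rewrite expr0 expr1n mul1r.
rewrite iterS; apply: le_trans (markov_op_contraction _) _.
  by rewrite mean_iter_markov_op.
by rewrite (exprS _ k) exprMn -[leRHS]mulrA ler_wpM2l ?sqr_ge0.
Qed.

End ReversibleChains.

(** * Two-point functions along a path *)

Lemma sum_tupleS (V : nmodType) (D : finType) N (F : N.+1.-tuple D -> V) :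
  \sum_(w : N.+1.-tuple D) F w = \sum_x \sum_(s : N.-tuple D) F (cons_tuple x s).
Proof.
rewrite pair_big (reindex (fun xs : D * N.-tuple D => cons_tuple xs.1 xs.2)) //=.
exists (fun w => (thead w, behead_tuple w)) => [[x s] _|w _].
  by rewrite /= theadE; congr pair; apply: val_inj.
by rewrite [RHS]tuple_eta; apply: val_inj.
Qed.

Section PathExpectation.
Variables (R : realType) (D : finType) (p : D -> D -> R).
Hypothesis p_trans : is_transition p.
Implicit Types (g h : D -> R).

Lemma sum_path_one_point m N x0 h x : (m <= N)%N ->
  \sum_(s : N.-tuple D) (\prod_(t <- pairmap p x s) t) * h (nth x0 (x :: s) m)
    = iter m (markov_op p) h x.
Proof.
elim: N m h x => [|N IH] [|m] h x //= mN.
- rewrite (big_pred1 [tuple]) => [|s]; first by rewrite big_nil mul1r.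
  by rewrite (tuple0 s); apply/esym/eqP.
(* Steps after the observed time carry total mass 1: the value [h x] is kept as a constant function
   and the induction hypothesis is applied to it at time 0. *)
- rewrite sum_tupleS -[RHS](markov_op_cst p_trans (h x) x).
  apply: eq_bigr => y _; rewrite /= -[h x in RHS](IH 0%N (fun=> h x) y) // mulr_sumr.
  by apply: eq_bigr => s _; rewrite /= big_cons mulrA.
- rewrite sum_tupleS; apply: eq_bigr => y _; rewrite -IH // mulr_sumr.
  by apply: eq_bigr => s _; rewrite /= big_cons mulrA.
Qed.

(** The Markov property at time [a]: the later factor is first averaged over [m] steps, then
    multiplied by [g] and averaged over the [a] earlier steps. *)
Lemma sum_path_two_point a m N x0 g h x : (a + m <= N)%N ->
  \sum_(s : N.-tuple D) (\prod_(t <- pairmap p x s) t)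
      * (g (nth x0 (x :: s) a) * h (nth x0 (x :: s) (a + m)))
    = iter a (markov_op p) (fun y => g y * iter m (markov_op p) h y) x.
Proof.
elim: a N x => [|a IH] [|N] x //= aN; rewrite ?add0n.
- by rewrite -(sum_path_one_point x0 _ _ aN) mulr_sumr; apply: eq_bigr => s _ /=; ring.
- by rewrite -(sum_path_one_point x0 _ _ aN) mulr_sumr; apply: eq_bigr => s _ /=; ring.
- rewrite sum_tupleS; apply: eq_bigr => y _; rewrite -(IH N) // mulr_sumr.
  by apply: eq_bigr => s _; rewrite /= big_cons -mulrA.
Qed.

Lemma expectation_two_point nu a m N x0 g h : (a + m < N)%N ->
  expectation p nu (fun w : N.-tuple D => g (nth x0 w a) * h (nth x0 w (a + m)))
    = \sum_x nu x * iter a (markov_op p) (fun y => g y * iter m (markov_op p) h y) x.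
Proof.
case: N => // N aN; rewrite /expectation sum_tupleS; apply: eq_bigr => x _.
rewrite -(sum_path_two_point x0 _ _ _ aN) mulr_sumr.
by apply: eq_bigr => s _; rewrite /= -mulrA.
Qed.

End PathExpectation.

(** * Double sums over time pairs, and comparison by level sets *)

Section Sums.
Variable R : realType.

(** [T] is the part on and above the diagonal. The square is covered by [T] and its transpose,
    whence the factor 2 (the diagonal is counted twice), and nonnegativity lets each row be extended
    to all lags below [n]. *)
Lemma sum_min_dist_le (a c : nat -> R) n :
  (forall j, 0 <= a j) -> (forall k, 0 <= c k) ->
  \sum_(j < n) \sum_(k < n) a (minn j k) * c (maxn j k - minn j k)%N
    <= 2 * (\sum_(j < n) a j) * \sum_(k < n) c k.
Proof.
move=> a0 c0.
pose T (j k : nat) := if (j <= k)%N then a j * c (k - j)%N else 0.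
have T0 j k : 0 <= T j k by rewrite /T; case: ifP => // _; rewrite mulr_ge0.
have half : \sum_(j < n) \sum_(k < n) T j k <= (\sum_(j < n) a j) * \sum_(k < n) c k.
  rewrite mulr_suml; apply: ler_sum => j _.
  rewrite -(big_mkord xpredT (T j)) (big_cat_nat (n := j)) //=; last exact/ltnW.
  rewrite [X in X + _]big_nat_cond big1 ?add0r => [|k]; last first.
    by rewrite andbT /T => /andP[_ kj]; rewrite leqNgt kj.
  rewrite -(big_mkord xpredT c) mulr_sumr -{1}[nat_of_ord j]add0n big_addn.
  rewrite [leRHS](big_cat_nat (n := (n - j)%N)) //= ?leq_subr //.
  rewrite ler_wpDr ?sumr_ge0 // => [k _|]; first by rewrite mulr_ge0.
  rewrite le_eqVlt; apply/orP; left; apply/eqP; apply: eq_bigr => k _.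
  by rewrite /T leq_addl addnK.
apply: le_trans (_ : \sum_(j < n) \sum_(k < n) (T j k + T k j) <= _).
  apply: ler_sum => j _; apply: ler_sum => k _.
  case: (leqP j k) => jk.
    by rewrite {1}/T jk lerDl.
  by rewrite [in T k j]/T (ltnW jk) lerDr.
under eq_bigr do rewrite big_split.
rewrite big_split /= [X in _ + X]exchange_big /=.
by apply: le_trans (lerD half half) _; rewrite -mulrA mulr2n mulrDl !mul1r.
Qed.

Lemma geometric_le (b : R) n : 0 <= b < 1 -> \sum_(j < n) b ^+ j <= (1 - b)^-1.
Proof.
move=> /andP[b0 b1]; rewrite -[leRHS]mul1r ler_pdivlMr ?subr_gt0 //.
have := subrX1 b n; have := exprn_ge0 n b0; lra.
Qed.

(* Both sides are integrals over t of the two level-set sums: remove the slab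
   below the least positive value of [u] and induct on its support. *)
Lemma layer_cake (I J : finType) (A u : I -> R) (B v : J -> R) :
  (forall x, 0 <= A x) -> (forall x, 0 <= u x) ->
  (forall y, 0 <= B y) -> (forall y, 0 <= v y) ->
  (forall t, 0 < t -> \sum_(x | t <= u x) A x <= \sum_(y | t < v y) B y) ->
  \sum_x A x * u x <= \sum_y B y * v y.
Proof.
move=> A0 + B0; have [k] := ubnP #|[pred x | 0 < u x]|.
elim: k u v => // k IH u v; rewrite ltnS => uk u0 v0 H.
have [x1 x1P|none] := pickP [pred x | 0 < u x]; last first.
  rewrite big1 => [|x _]; first by apply: sumr_ge0 => y _; rewrite mulr_ge0.
  have := none x; rewrite /= => /negbT; rewrite -leNgt => ux.
  by have -> : u x = 0; [apply/eqP; rewrite eq_le ux u0|rewrite mulr0].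
have [/= x2 x2P x2min] := @arg_minP _ R I x1 [pred x | 0 < u x] u x1P.
set t := u x2 in x2P x2min *.
pose u' x := if 0 < u x then u x - t else 0.
pose v' y := Num.max (v y - t) 0.
have -> : \sum_x A x * u x = \sum_x A x * u' x + t * \sum_(x | t <= u x) A x.
  rewrite mulr_sumr [X in _ + X]big_mkcond -big_split; apply: eq_bigr => x _ /=.
  rewrite /u'; case: ifPn => [ux|]; first by rewrite x2min //; ring.
  rewrite -leNgt => ux; have -> : u x = 0 by apply/eqP; rewrite eq_le ux u0.
  by rewrite leNgt x2P /= !mulr0 addr0.
(* For [v] removing the slab gives only an inequality, since its values may lie strictly between 0
   and [t]; truncation sends those to 0. *)
apply: le_trans (_ : \sum_y B y * v' y + t * \sum_(y | t < v y) B y <= _); last first.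
  rewrite mulr_sumr [X in _ + X]big_mkcond -big_split; apply: ler_sum => y _ /=.
  rewrite /v'; case: ifPn => tv.
    by rewrite max_l; [rewrite le_eqVlt; apply/orP; left; apply/eqP; ring|lra].
  by rewrite addr0 ler_wpM2l // ge_max v0 andbT; have := ltW x2P; lra.
apply: lerD; last by rewrite ler_wpM2l ?H // ltW.
apply: IH.
- apply: leq_trans uk; apply: proper_card; apply/properP; split.
    apply/fintype.subsetP => x; rewrite !inE /u'; case: ifP => //.
    by rewrite ltxx.
  by exists x2; rewrite !inE // /u' x2P subrr ltxx.
- by move=> x; rewrite /u'; case: ifP => // ux; rewrite subr_ge0 x2min.
- by move=> y; rewrite /v' le_max lexx orbT.
- move=> s s0; have := H (s + t) (addr_gt0 s0 x2P).
  rewrite (eq_bigl (fun x => s <= u' x)) => [|x]; last first.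
    rewrite /u'; case: ifPn => [_|]; first by rewrite lerBrDr.
    rewrite -leNgt => ux; rewrite [RHS]leNgt s0 /= leNgt.
    by rewrite (le_lt_trans ux) // addr_gt0.
  move/le_trans; apply; rewrite le_eqVlt; apply/orP; left; apply/eqP.
  by apply: eq_bigl => y; rewrite /v' lt_max ltrBrDr [s < 0]ltNge (ltW s0) orbF.
Qed.

End Sums.

(** * Interpolation *)

Section MonteCarloError.
Variables (R : realType) (D : finType) (p : D -> D -> R) (pi : D -> R).
Hypothesis p_trans : is_transition p.
Hypothesis p_irr : irreducible p.
Hypothesis pi_distr : is_distribution pi.
Hypothesis p_rev : reversible p pi.
Implicit Types (f g h : D -> R).

Let pi_ge0 x : 0 <= pi x. Proof. by have [] := pi_distr. Qed.
Let pi_sum1 : \sum_x pi x = 1. Proof. by have [] := pi_distr. Qed.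

Lemma dot_pi_ge0 f : 0 <= dot_pi pi f f.
Proof. by apply: sumr_ge0 => x _; rewrite mulr_ge0 // -expr2 sqr_ge0. Qed.

(** Lagrange's identity: twice the gap is a double sum of weighted squares, which avoids dividing by
    a norm. *)
Lemma dot_pi_cauchy_schwarz f g :
  dot_pi pi f g ^+ 2 <= dot_pi pi f f * dot_pi pi g g.
Proof.
rewrite -subr_ge0 -(pmulr_rge0 _ (ltr0n R 2)).
have -> : 2 * (dot_pi pi f f * dot_pi pi g g - dot_pi pi f g ^+ 2)
    = \sum_x \sum_y (f x * g y - f y * g x) ^+ 2 * (pi x * pi y).
  have prodE (a c : D -> R) : (\sum_x a x) * (\sum_y c y) = \sum_x \sum_y a x * c y.
    by rewrite mulr_suml; apply: eq_bigr => x _; rewrite mulr_sumr.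
  have -> : 2 * (dot_pi pi f f * dot_pi pi g g - dot_pi pi f g ^+ 2)
    = dot_pi pi f f * dot_pi pi g g + dot_pi pi g g * dot_pi pi f f
      - 2 * (dot_pi pi f g * dot_pi pi f g) by ring.
  rewrite !prodE mulr_sumr -sumrN -!big_split; apply: eq_bigr => x _ /=.
  rewrite mulr_sumr -sumrN -!big_split; apply: eq_bigr => y _ /=; ring.
by apply: sumr_ge0 => x _; apply: sumr_ge0 => y _; rewrite mulr_ge0 ?sqr_ge0 ?mulr_ge0.
Qed.

Lemma dot_pi_norm_le f g a c : 0 <= a -> 0 <= c ->
  dot_pi pi f f <= a ^+ 2 -> dot_pi pi g g <= c ^+ 2 ->
  `|dot_pi pi f g| <= a * c.
Proof.
move=> a0 c0 fa gc; rewrite -(@ler_pXn2r _ 2) ?nnegrE ?mulr_ge0 //.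
rewrite real_normK ?num_real // (le_trans (dot_pi_cauchy_schwarz f g)) //.
by rewrite exprMn ler_pM ?dot_pi_ge0.
Qed.

Lemma mean_sub_mean f : mean pi (fun x => f x - mean pi f) = 0.
Proof.
rewrite /mean; under eq_bigr do rewrite mulrBl.
by rewrite sumrB -mulr_sumr pi_sum1 mulr1 subrr.
Qed.

Lemma variance_le f :
  dot_pi pi (fun x => f x - mean pi f) (fun x => f x - mean pi f) <= dot_pi pi f f.
Proof.
have -> : dot_pi pi (fun x => f x - mean pi f) (fun x => f x - mean pi f)
    = dot_pi pi f f - mean pi f ^+ 2; last by rewrite lerBlDr lerDl sqr_ge0.
move sE : (mean pi f) => s.
transitivity (dot_pi pi f f - 2 * s * mean pi f + s ^+ 2 * \sum_x pi x).
  rewrite /dot_pi /mean !mulr_sumr -sumrN -!big_split; apply: eq_bigr => x _ /=; ring.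
by rewrite pi_sum1 sE; ring.
Qed.

Lemma mean_norm_le f c : (forall x, `|f x| <= c) -> `|mean pi f| <= c.
Proof.
move=> fc; apply: le_trans (ler_norm_sum _ _ _) _.
rewrite -[leRHS]mulr1 -pi_sum1 mulr_sumr; apply: ler_sum => x _.
by rewrite normrM (ger0_norm (pi_ge0 x)) ler_wpM2r.
Qed.

Lemma iter_markov_opB k f g x :
  iter k (markov_op p) (fun y => f y - g y) x
    = iter k (markov_op p) f x - iter k (markov_op p) g x.
Proof.
elim: k x => //= k IH x; rewrite /markov_op -sumrB; apply: eq_bigr => y _.
by rewrite -mulrBr -IH.
Qed.

(* Marcinkiewicz interpolation between the bounds [beta ^+ k] on L^2 and [2]
   on L^oo for [f |-> P^k (f - mean f)]: at height [t] of the squared image,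
   split [f] at [sqrt t / 4]. *)
Lemma iter_markov_op_L4 k f :
  \sum_x iter k (markov_op p) (fun y => f y - mean pi f) x ^+ 4 * pi x
    <= 64 * (beta p ^+ k) ^+ 2 * \sum_x f x ^+ 4 * pi x.
Proof.
set g := fun y => f y - mean pi f; set Tg := iter k (markov_op p) g.
(* One square goes into the weight, so that the sums over level sets are truncated squared L^2
   norms, where the spectral contraction applies. On the other side 64 = 4 * 16, with 16 from the
   cut at [sqrt t / 4] and 4 from the loss of a factor 2 on the level set. *)
have -> : \sum_x Tg x ^+ 4 * pi x = \sum_x Tg x ^+ 2 * pi x * Tg x ^+ 2.
  by apply: eq_bigr => x _; ring.
have -> : 64 * (beta p ^+ k) ^+ 2 * (\sum_x f x ^+ 4 * pi x)
    = \sum_x 4 * (beta p ^+ k) ^+ 2 * f x ^+ 2 * pi x * (16 * f x ^+ 2).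
  by rewrite mulr_sumr; apply: eq_bigr => x _; ring.
apply: layer_cake => [x|x|x|x|t t0]; rewrite ?sqr_ge0 //.
- by rewrite mulr_ge0 ?sqr_ge0.
- by rewrite mulr_ge0 // mulr_ge0 ?sqr_ge0 // mulr_ge0 ?sqr_ge0.
- by rewrite mulr_ge0 ?sqr_ge0.
pose fb y := if t < 16 * f y ^+ 2 then f y else 0.
pose gb y := fb y - mean pi fb.
(* The discarded part of [f] and its mean are each at most [sqrt t / 4], and averaging does not
   increase the sup norm. *)
have small x : `|Tg x - iter k (markov_op p) gb x| <= Num.sqrt t / 2.
  rewrite -iter_markov_opB; apply: iter_markov_op_norm_le => // y.
  have fs z : `|f z - fb z| <= Num.sqrt t / 4.
    rewrite /fb; case: ifPn => [_|]; first by rewrite subrr normr0 divr_ge0.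
    rewrite -leNgt subr0 => ft.
    rewrite -(@ler_pXn2r _ 2) ?nnegrE ?divr_ge0 // exprMn sqr_sqrtr ?(ltW t0) //.
    by rewrite real_normK ?num_real //; lra.
  have := mean_norm_le fs; have := fs y.
  have -> : mean pi (fun z => f z - fb z) = mean pi f - mean pi fb.
    by rewrite /mean -sumrB; apply: eq_bigr => z _; rewrite mulrBl.
  by rewrite /g /gb !ler_norml; lra.
(* On the level set the error [sqrt t / 2] is at most half of [|Tg x|], so [|Tg x|] is at most twice
   the image of the truncated part. *)
apply: le_trans (_ : \sum_x 4 * (iter k (markov_op p) gb x ^+ 2 * pi x) <= _).
  rewrite big_mkcond; apply: ler_sum => x _; case: ifPn => [tx|_]; last first.
    by rewrite mulr_ge0 // mulr_ge0 ?sqr_ge0.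
  rewrite mulrA ler_wpM2r //.
  have : Num.sqrt t <= `|Tg x|.
    by rewrite -(@ler_pXn2r _ 2) ?nnegrE // sqr_sqrtr ?(ltW t0) // real_normK ?num_real.
  have := small x; set z := iter k _ gb x.
  have := lerB_dist (Tg x) (Tg x - z); rewrite subKr => h1 h2 h3.
  have -> : 4 * z ^+ 2 = (2 * `|z|) ^+ 2 by rewrite exprMn real_normK ?num_real //; ring.
  rewrite -[X in X <= _](real_normK (num_real (Tg x))).
  by rewrite ler_pXn2r ?nnegrE ?mulr_ge0 //; lra.
rewrite -mulr_sumr.
have := iter_markov_op_contraction p_trans p_irr pi_distr p_rev k (mean_sub_mean fb).
rewrite -/gb => hc; have hv := variance_le fb.
have b0 := sqr_ge0 (beta p ^+ k).
apply: le_trans (_ : 4 * ((beta p ^+ k) ^+ 2 * dot_pi pi fb fb) <= _).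
  rewrite ler_wpM2l //.
  have -> : \sum_i iter k (markov_op p) gb i ^+ 2 * pi i
    = dot_pi pi (iter k (markov_op p) gb) (iter k (markov_op p) gb).
    by apply: eq_bigr => x _; rewrite expr2.
  by apply: le_trans hc _; rewrite ler_wpM2l.
rewrite le_eqVlt; apply/orP; left; apply/eqP.
rewrite [RHS]big_mkcond /dot_pi !mulr_sumr; apply: eq_bigr => x _.
by rewrite /fb; case: ifP => _; rewrite ?mul0r ?mulr0 //; ring.
Qed.

End MonteCarloError.

(** * Burn-in and bias *)

Section BurnIn.
Variables (R : realType) (D : finType).

Lemma burn_in_le1 (b C : R) : 0 < b < 1 -> 0 <= C -> b ^+ burn_in b C * C <= 1.
Proof.
move=> /andP[b0 b1] C0; rewrite /burn_in; case: eqVneq => [->|C_neq0].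
  by rewrite mulr0 ler01.
have C_gt0 : 0 < C by rewrite lt0r C_neq0.
set k := `|_|%N; have Vb1 : 1 < b^-1 by rewrite invf_gt1.
have kP : ln C / ln b^-1 <= k%:R.
  rewrite /k natr_absz; apply: le_trans (ceil_ge _) _.
  by rewrite ler_int (le_trans _ (ler_norm _)) // le_max lexx.
rewrite ler_pdivrMr ?ln_gt0 // mulr_natl -lnXn ?invr_gt0 // in kP.
rewrite ler_ln ?posrE ?exprn_gt0 ?invr_gt0 // exprVn in kP.
by rewrite mulrC -ler_pdivlMr ?exprn_gt0 // mul1r.
Qed.

Lemma sup_norm_ge (f : D -> R) x : `|f x| <= sup_norm f.
Proof. exact: le_bigmax. Qed.

Lemma sup_norm_ge0 (f : D -> R) : 0 <= sup_norm f.
Proof. exact: bigmax_ge_id. Qed.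

Lemma lp_norm_le1 (pi : D -> R) q (f : D -> R) :
  (0 < q)%N -> (forall x, 0 <= pi x) -> lp_norm pi q%:R f <= 1 ->
  \sum_x `|f x| ^+ q * pi x <= 1.
Proof.
move=> q0 pi0; rewrite /lp_norm; under eq_bigr do rewrite powR_mulrn //.
set s := \sum_x _ => h; have s0 : 0 <= s.
  by apply: sumr_ge0 => x _; rewrite mulr_ge0 ?exprn_ge0.
rewrite leNgt; apply/negP => s1.
have Vq : 0 < (q%:R : R)^-1 by rewrite invr_gt0 ltr0n.
have := @gt0_ltr_powR R _ Vq 1 s.
rewrite !nnegrE ler01 s0 s1 powR1 => /(_ isT isT isT).
by rewrite ltNge h.
Qed.

Lemma worst_sq_error_le p (pi nu : D -> R) n n0 norm (B : R) : 0 <= B ->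
  (forall f, norm f <= 1 -> expectation p nu (fun w : (n0 + n).-tuple D =>
       `|sample_mean f w - mean pi f| ^+ 2) <= B) ->
  (worst_sq_error p pi nu n n0 norm <= B%:E)%E.
Proof.
move=> B0 H; apply: ge_ereal_sup => _ [f nf <-]; rewrite lee_fin /mc_error.
set E := expectation _ _ _; have EB : E <= B by exact: H.
(* [Num.sqrt] is 0 on negative arguments, and [0 <= B] covers that case. *)
case: (leP 0 E) => E0; first by rewrite sqr_sqrtr.
by rewrite ltr0_sqrtr // expr0n.
Qed.

End BurnIn.

(** * Variance bound and the bias of the initial law *)

Section Variances.
Variables (R : realType) (D : finType) (p : D -> D -> R) (pi nu : D -> R).
Hypothesis p_trans : is_transition p.
Hypothesis p_irr : irreducible p.
Hypothesis pi_distr : is_distribution pi.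
Hypothesis p_rev : reversible p pi.
Hypothesis nu_distr : is_distribution nu.
Hypothesis beta01 : 0 < beta p < 1.
Implicit Types (f g h : D -> R).

Let b := beta p.
Let dev x := nu x / pi x - 1.
Let pi_ge0 x : 0 <= pi x. Proof. by have [] := pi_distr. Qed.
Let pi_sum1 : \sum_x pi x = 1. Proof. by have [] := pi_distr. Qed.
Let pi_gt0 x : 0 < pi x. Proof. exact: (stationary_gt0 p_trans p_irr pi_distr p_rev). Qed.
Let b_gt0 : 0 < b. Proof. by case/andP: beta01. Qed.
Let b_lt1 : b < 1. Proof. by case/andP: beta01. Qed.

Let dev_pi x : dev x * pi x = nu x - pi x.
Proof. by rewrite /dev mulrBl mul1r mulfVK ?gt_eqF. Qed.

Let mean_dev : mean pi dev = 0.
Proof.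
rewrite /mean; under eq_bigr do rewrite dev_pi.
by rewrite sumrB pi_sum1 (proj2 nu_distr) subrr.
Qed.

Let dev_L2 : dot_pi pi dev dev <= sup_norm dev.
Proof.
have -> : dot_pi pi dev dev = \sum_x dev x * nu x - mean pi dev.
  by rewrite /dot_pi /mean -sumrB; apply: eq_bigr => x _; rewrite -mulrBr -dev_pi mulrA.
rewrite mean_dev subr0 -[leRHS]mulr1 -(proj2 nu_distr) mulr_sumr.
apply: ler_sum => x _; rewrite ler_wpM2r ?(proj1 nu_distr) //.
exact: le_trans (ler_norm _) (sup_norm_ge _ _).
Qed.

(** Write [nu] as [pi] plus [dev * pi]: stationarity removes the iterate from the first part, and
    self-adjointness moves it onto [dev] in the second. *)
Let sum_nu_iter k h : \sum_x nu x * iter k (markov_op p) h x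
  = mean pi h + dot_pi pi (iter k (markov_op p) dev) h.
Proof.
rewrite (dot_pi_iter_markov_op p_rev) // -(mean_iter_markov_op p_trans p_rev k h).
rewrite /mean /dot_pi -big_split; apply: eq_bigr => x _ /=.
by rewrite mulrAC dev_pi; ring.
Qed.

Let iter_dev_L2 k :
  dot_pi pi (iter k (markov_op p) dev) (iter k (markov_op p) dev)
    <= (b ^+ k * Num.sqrt (sup_norm dev)) ^+ 2.
Proof.
have := iter_markov_op_contraction p_trans p_irr pi_distr p_rev k mean_dev.
move/le_trans; apply; rewrite exprMn sqr_sqrtr ?sup_norm_ge0 //.
by rewrite ler_wpM2l ?sqr_ge0.
Qed.

Let centered f := fun x => f x - mean pi f.

Let iter_centered_L2 k f : dot_pi pi f f <= 1 ->
  dot_pi pi (iter k (markov_op p) (centered f)) (iter k (markov_op p) (centered f))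
    <= (b ^+ k) ^+ 2.
Proof.
move=> f1; have fc := mean_sub_mean pi_distr f.
have := iter_markov_op_contraction p_trans p_irr pi_distr p_rev k fc.
move/le_trans; apply; rewrite -[leRHS]mulr1 ler_wpM2l ?sqr_ge0 //.
exact: le_trans (variance_le pi_distr f) f1.
Qed.

(* The correlation of [g(X_j)] and [g(X_k)] splits into its stationary value
   and the bias [<P^(n0 + min j k) dev, g P^|j - k| g>] of the initial law. *)
Lemma mc_error_le n n0 f K r : (0 < n)%N -> 0 <= r < 1 -> 0 <= K ->
  dot_pi pi f f <= 1 ->
  (forall a m, `|dot_pi pi (iter (n0 + a) (markov_op p) dev)
       (fun x => centered f x * iter m (markov_op p) (centered f) x)|
     <= K * (b ^+ a * r ^+ m)) ->
  expectation p nu (fun w : (n0 + n).-tuple D =>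
       `|sample_mean f w - mean pi f| ^+ 2)
    <= 2 / (n%:R * (1 - b)) + 2 * K / (n%:R ^+ 2 * (1 - b) * (1 - r)).
Proof.
move=> n_gt0 r01 K0 f1 bias; set g := centered f.
have nR0 : n%:R != 0 :> R by rewrite pnatr_eq0 -lt0n.
have [x0 _|D0] := pickP (@predT D); last first.
  by have := oner_eq0 R; rewrite -pi_sum1 big_pred0 ?eqxx.
pose cor a m := \sum_x nu x * iter (n0 + a) (markov_op p)
    (fun y => g y * iter m (markov_op p) g y) x.
have -> : expectation p nu (fun w : (n0 + n).-tuple D =>
       `|sample_mean f w - mean pi f| ^+ 2)
    = n%:R ^- 2 * \sum_(j < n) \sum_(k < n) cor (minn j k) (maxn j k - minn j k)%N.
  transitivity (n%:R ^- 2 * \sum_(j < n) \sum_(k < n)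
     expectation p nu (fun w : (n0 + n).-tuple D =>
        g (nth x0 w (n0 + j)) * g (nth x0 w (n0 + k)))).
    rewrite /expectation; under [in RHS]eq_bigr do rewrite exchange_big /=.
    rewrite exchange_big mulr_sumr; apply: eq_bigr => w _.
    under eq_bigr do rewrite -mulr_sumr.
    rewrite -mulr_sumr [RHS]mulrCA; congr (_ * _).
    rewrite real_normK ?num_real //.
    have -> : sample_mean f w - mean pi f
        = n%:R^-1 * \sum_(j < n) g (nth x0 w (n0 + j)).
      have -> : \sum_(j < n) g (nth x0 w (n0 + j))
          = \sum_(i < n) f (tnth w (rshift n0 i)) - \sum_(i < n) mean pi f.
        by rewrite -sumrB; apply: eq_bigr => j _; rewrite (tnth_nth x0).
      rewrite sumr_const card_ord mulrBr -[mean pi f *+ n]mulr_natl.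
      by rewrite mulKf.
    rewrite exprMn exprVn; congr (_ * _).
    by rewrite expr2 mulr_suml; apply: eq_bigr => j _; rewrite mulr_sumr.
  congr (_ * _); apply: eq_bigr => j _; apply: eq_bigr => k _.
  wlog jk : j k / (j <= k)%N => [H|].
    have /orP[jk|kj] := leq_total j k; first exact: H.
    rewrite minnC maxnC -(H k j kj).
    by apply: eq_bigr => w _; rewrite [g _ * g _]mulrC.
  rewrite (minn_idPl jk) (maxn_idPr jk).
  have lt : ((n0 + j) + (k - j) < n0 + n)%N by rewrite -addnA subnKC // ltn_add2l.
  rewrite /cor -(expectation_two_point p_trans nu x0 g g lt).
  by rewrite -addnA subnKC.
(* The factor 1 gives the stationary term the shape weight of the minimum times weight of the lag,
   which [sum_min_dist_le] sums. *)
have corE a m : cor a m <= 1 * b ^+ m + K * (b ^+ a * r ^+ m).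
  rewrite /cor sum_nu_iter; apply: lerD; last exact: le_trans (ler_norm _) (bias a m).
  have -> : mean pi (fun y => g y * iter m (markov_op p) g y)
    = dot_pi pi g (iter m (markov_op p) g) by [].
  apply: le_trans (ler_norm _) (dot_pi_norm_le pi_distr _ _ _ _) => //.
  - by rewrite exprn_ge0 ?ltW.
  - by have := iter_centered_L2 0 f1; rewrite expr0.
  - exact: iter_centered_L2.
have [/andP[r0 r1] b01] : 0 <= r < 1 /\ 0 <= b < 1 by rewrite r01 (ltW b_gt0) b_lt1.
apply: le_trans (_ : n%:R ^- 2 * (2 * (n%:R * (1 - b)^-1)
    + K * (2 * ((1 - b)^-1 * (1 - r)^-1))) <= _); last first.
  rewrite le_eqVlt; apply/orP; left; apply/eqP; field.
  by rewrite nR0 !subr_eq0 !gt_eqF.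
rewrite ler_wpM2l ?invr_ge0 ?exprn_ge0 ?ler0n //.
apply: le_trans (_ : \sum_(j < n) \sum_(k < n)
   (1 * b ^+ (maxn j k - minn j k)
    + K * (b ^+ minn j k * r ^+ (maxn j k - minn j k))) <= _).
  by apply: ler_sum => j _; apply: ler_sum => k _; exact: corE.
have -> : \sum_(j < n) \sum_(k < n)
     (1 * b ^+ (maxn j k - minn j k)
      + K * (b ^+ minn j k * r ^+ (maxn j k - minn j k)))
   = \sum_(j < n) \sum_(k < n) 1 * b ^+ (maxn j k - minn j k)
     + K * \sum_(j < n) \sum_(k < n) (b ^+ minn j k * r ^+ (maxn j k - minn j k)).
  rewrite mulr_sumr -big_split; apply: eq_bigr => j _ /=.
  by rewrite mulr_sumr -big_split.
apply: lerD.
  apply: le_trans (@sum_min_dist_le R (fun=> 1) (fun m => b ^+ m) n _ _) _ => // [k|].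
    by rewrite exprn_ge0 ?ltW.
  rewrite -mulrA ler_wpM2l // sumr_const card_ord ler_wpM2l ?ler0n //.
  exact: geometric_le.
rewrite ler_wpM2l //.
apply: le_trans (@sum_min_dist_le R (fun a => b ^+ a) (fun m => r ^+ m) n _ _) _.
- by move=> j; rewrite exprn_ge0 ?ltW.
- by move=> j; rewrite exprn_ge0.
rewrite -mulrA ler_wpM2l // ler_pM ?sumr_ge0 ?geometric_le //.
  by move=> j _; rewrite exprn_ge0 // ltW.
by move=> j _; rewrite exprn_ge0.
Qed.

(** A single term of the squared L^2 norm gives [u x ^+ 2 <= dot_pi pi u u / pi x]. With the iterate
    of [dev] thus bounded pointwise, Cauchy-Schwarz is left for the two factors in [centered f]. *)
Lemma bias_L2 n0 f : dot_pi pi f f <= 1 ->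
  b ^+ n0 * (Num.sqrt (sup_norm (fun x => 1 / pi x)) * Num.sqrt (sup_norm dev)) <= 1 ->
  forall a m, `|dot_pi pi (iter (n0 + a) (markov_op p) dev)
      (fun x => centered f x * iter m (markov_op p) (centered f) x)|
    <= 1 * (b ^+ a * b ^+ m).
Proof.
move=> f1 hC a m; set u := iter _ _ dev; set T := iter m _ _.
have u_le x : `|u x| <= b ^+ a.
  apply: le_trans (_ : b ^+ (n0 + a) * Num.sqrt (sup_norm dev)
      * Num.sqrt (sup_norm (fun x => 1 / pi x)) <= _); last first.
    rewrite exprD -[leRHS]mul1r.
    apply: le_trans (ler_wpM2r (exprn_ge0 a (ltW b_gt0)) hC).
    by rewrite le_eqVlt; apply/orP; left; apply/eqP; ring.
  rewrite -(@ler_pXn2r _ 2) ?nnegrE ?mulr_ge0 ?exprn_ge0 ?(ltW b_gt0) //.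
  rewrite real_normK ?num_real // exprMn [X in _ * X]sqr_sqrtr ?sup_norm_ge0 //.
  apply: le_trans (_ : dot_pi pi u u * (1 / pi x) <= _).
    rewrite mul1r ler_pdivlMr // /dot_pi (bigD1 x) //= -expr2 lerDl.
    by apply: sumr_ge0 => y _; rewrite mulr_ge0 // -expr2 sqr_ge0.
  apply: ler_pM (iter_dev_L2 _) _; rewrite ?dot_pi_ge0 ?divr_ge0 //.
  exact: le_trans (ler_norm _) (sup_norm_ge (fun x => 1 / pi x) x).
apply: le_trans (_ : b ^+ a * dot_pi pi (fun x => `|centered f x|) (fun x => `|T x|) <= _).
  apply: le_trans (ler_norm_sum _ _ _) _; rewrite mulr_sumr; apply: ler_sum => x _.
  by rewrite !normrM (ger0_norm (pi_ge0 x)) -!mulrA ler_wpM2r ?mulr_ge0.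
rewrite mul1r ler_wpM2l ?exprn_ge0 ?(ltW b_gt0) // -[leRHS]mul1r.
have normE h : dot_pi pi (fun x => `|h x|) (fun x => `|h x|) = dot_pi pi h h.
  by apply: eq_bigr => x _; rewrite -normrM ger0_norm // -expr2 sqr_ge0.
apply: le_trans (ler_norm _) (dot_pi_norm_le pi_distr _ _ _ _) => //.
- by rewrite exprn_ge0 ?ltW.
- by rewrite normE; have := iter_centered_L2 0 f1; rewrite expr0.
- by rewrite normE; exact: iter_centered_L2.
Qed.

(** Cauchy-Schwarz between the iterate of [dev] and the product, whose L^2 norm is at most
    [L * r ^+ m]; [K] is what the burn-in leaves of the constants. *)
Lemma bias_le n0 f L K r : 0 <= L -> 0 <= r ->
  (forall m, \sum_x (centered f x * iter m (markov_op p) (centered f) x) ^+ 2 * pi x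
     <= (L * r ^+ m) ^+ 2) ->
  b ^+ n0 * (Num.sqrt (sup_norm dev) * L) <= K ->
  forall a m, `|dot_pi pi (iter (n0 + a) (markov_op p) dev)
      (fun x => centered f x * iter m (markov_op p) (centered f) x)|
    <= K * (b ^+ a * r ^+ m).
Proof.
move=> L0 r0 H hC a m.
apply: le_trans (dot_pi_norm_le pi_distr _ _ (iter_dev_L2 _) (H m)) _.
- by rewrite mulr_ge0 ?exprn_ge0 ?(ltW b_gt0).
- by rewrite mulr_ge0 ?exprn_ge0.
have ab0 : 0 <= b ^+ a * r ^+ m by rewrite mulr_ge0 ?exprn_ge0 ?(ltW b_gt0).
apply: le_trans (ler_wpM2r ab0 hC).
by rewrite exprD le_eqVlt; apply/orP; left; apply/eqP; ring.
Qed.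

Lemma product_L2_of_bounded f m : dot_pi pi f f <= 1 -> (forall x, `|f x| <= 1) ->
  \sum_x (centered f x * iter m (markov_op p) (centered f) x) ^+ 2 * pi x
    <= (2 * b ^+ m) ^+ 2.
Proof.
move=> f1 fb; rewrite exprMn.
apply: le_trans (ler_wpM2l (sqr_ge0 2) (iter_centered_L2 m f1)).
rewrite mulr_sumr; apply: ler_sum => x _; set T := iter _ _ _.
have -> : 2 ^+ 2 * (T x * T x * pi x) = 2 ^+ 2 * (T x ^+ 2 * pi x) by ring.
have T0 : 0 <= T x ^+ 2 * pi x by rewrite mulr_ge0 ?sqr_ge0.
rewrite exprMn -mulrA ler_wpM2r //.
have g2 : `|centered f x| <= 2.
  by have := fb x; have := mean_norm_le pi_distr fb; rewrite !ler_norml /centered; lra.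
by rewrite -(real_normK (num_real (centered f x))) ler_pXn2r ?nnegrE.
Qed.

(** Cauchy-Schwarz on squares, with the interpolation bound taken at 0 and at [m] steps: the squared
    norm is at most 8 times [8 * b ^+ m], so the rate after the square root is [Num.sqrt b]. *)
Lemma product_L2_of_L4 f m : \sum_x f x ^+ 4 * pi x <= 1 ->
  \sum_x (centered f x * iter m (markov_op p) (centered f) x) ^+ 2 * pi x
    <= (8 * Num.sqrt b ^+ m) ^+ 2.
Proof.
move=> f4; set T := iter m _ _.
have L4 k : dot_pi pi (fun x => iter k (markov_op p) (centered f) x ^+ 2)
     (fun x => iter k (markov_op p) (centered f) x ^+ 2) <= (8 * b ^+ k) ^+ 2.
  apply: le_trans (_ : 64 * (b ^+ k) ^+ 2 * \sum_x f x ^+ 4 * pi x <= _).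
    have := iter_markov_op_L4 p_trans p_irr pi_distr p_rev k f.
    apply: le_trans; rewrite le_eqVlt; apply/orP; left; apply/eqP.
    by apply: eq_bigr => x _; ring.
  have -> : (8 * b ^+ k) ^+ 2 = 64 * (b ^+ k) ^+ 2 * 1 by ring.
  by rewrite ler_wpM2l // mulr_ge0 ?sqr_ge0.
have -> : (8 * Num.sqrt b ^+ m) ^+ 2 = 8 * b ^+ 0 * (8 * b ^+ m).
  by rewrite exprMn exprAC sqr_sqrtr ?(ltW b_gt0) // expr0; ring.
have b8 k : 0 <= 8 * b ^+ k by rewrite mulr_ge0 ?exprn_ge0 ?(ltW b_gt0).
apply: le_trans (dot_pi_norm_le pi_distr (b8 0%N) (b8 m) (L4 0%N) (L4 m)).
apply: le_trans (ler_norm _); rewrite le_eqVlt; apply/orP; left; apply/eqP.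
by apply: eq_bigr => x _; rewrite exprMn.
Qed.

End Variances.

Theorem corollary12 (R : realType) (D : finType) (pi nu : D -> R)
    (p : D -> D -> R) (n : nat)
    (cardD : (2 <= #|D|)%N)
    (pi_distr : is_distribution pi)
    (p_trans : is_transition p)
    (p_erg : ergodic p)
    (p_rev : reversible p pi)
    (beta1E : eigenval p 1 = beta p)
    (beta_gt0 : 0 < beta p)
    (nu_distr : is_distribution nu)
    (n_ge1 : (1 <= n)%N) :
  let b := beta p in
  let dev := sup_norm (fun x => nu x / pi x - 1) in
  [/\ (let C := Num.sqrt (sup_norm (fun x => 1 / pi x)) * Num.sqrt dev in
       (worst_sq_error p pi nu n (burn_in b C) (lp_norm pi 2)
         <= (2 / (n%:R * (1 - b)) + 2 / (n%:R ^+ 2 * (1 - b) ^+ 2))%:E)%E),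
      (let C := 16 * Num.sqrt 2 * Num.sqrt dev in
       (worst_sq_error p pi nu n (burn_in b C) (lp_norm pi 4)
         <= (2 / (n%:R * (1 - b))
             + 1 / (n%:R ^+ 2 * (1 - b) * (1 - Num.sqrt b)))%:E)%E)
    & (let C := 2 * Num.sqrt dev in
       (worst_sq_error p pi nu n (burn_in b C) (@sup_norm R D)
         <= (2 / (n%:R * (1 - b)) + 2 / (n%:R ^+ 2 * (1 - b) ^+ 2))%:E)%E)].
Proof.
(* For the L^4 case, with [q] the decay over the burn-in, [s] the root of [dev] and [t] the root of
   2: the constant 8 becomes [2^-1], so that [2 * K] is the numerator 1. *)
have half_bound (q s t : R) : 0 <= q * s -> 1 <= t ->
    q * (16 * t * s) <= 1 -> q * (s * 8) <= 2^-1.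
  by move=> qs0 /(ler_wpM2l qs0); lra.
move=> b dev; have p_irr := proj1 p_erg.
(* Since [beta p] is the second eigenvalue here, the simplicity of the eigenvalue 1 gives the strict
   bound. *)
have b_lt1 : b < 1.
  by rewrite /b -beta1E; exact: eigenval1_lt1 p_trans p_irr pi_distr p_rev cardD.
have b01 : 0 < beta p < 1 by rewrite beta_gt0.
have b01' : 0 <= b < 1 by rewrite (ltW beta_gt0).
have [pi_ge0 pi_sum1] := pi_distr.
have sb01 : 0 <= Num.sqrt b < 1 by rewrite sqrtr_ge0 -[ltRHS]sqrtr1 ltr_sqrt.
have n0 : 0 <= n%:R :> R by rewrite ler0n.
have boundE (K r B : R) : 0 <= r < 1 -> 0 <= K -> 2 * K = B ->
  0 <= 2 / (n%:R * (1 - b)) + B / (n%:R ^+ 2 * (1 - b) * (1 - r)).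
  move=> /andP[r0 r1] K0 <-.
  by rewrite addr_ge0 // divr_ge0 ?mulr_ge0 ?subr_ge0 ?exprn_ge0 // ltW.
have sqE f : dot_pi pi f f = \sum_x `|f x| ^+ 2 * pi x.
  by apply: eq_bigr => x _; rewrite real_normK ?num_real.
have main := mc_error_le (nu := nu) p_trans p_irr pi_distr p_rev b01 n_ge1.
split=> C.
- have hC : b ^+ burn_in b C * C <= 1 by rewrite burn_in_le1 ?b01 ?mulr_ge0.
  have e : n%:R ^+ 2 * (1 - b) ^+ 2 = n%:R ^+ 2 * (1 - b) * (1 - b) :> R by ring.
  rewrite e; apply: worst_sq_error_le => [|f]; first by apply: (boundE 1); rewrite ?mulr1.
  move=> /(lp_norm_le1 (isT : (0 < 2)%N) pi_ge0); rewrite -sqE => f1.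
  rewrite -[X in X / (_ * (1 - b) * _)]mulr1.
  exact: (main _ _ _ _ b01' ler01 f1
    (bias_L2 p_trans p_irr pi_distr p_rev nu_distr b01 f1 hC)).
- have hC : b ^+ burn_in b C * C <= 1 by rewrite burn_in_le1 ?b01 ?mulr_ge0.
  have K0 : 0 <= 2^-1 :> R by rewrite invr_ge0.
  apply: worst_sq_error_le => [|f].
    by apply: (boundE 2^-1); rewrite ?mulfV ?pnatr_eq0.
  move=> /(lp_norm_le1 (isT : (0 < 4)%N) pi_ge0) f4.
  have f4' : \sum_x f x ^+ 4 * pi x <= 1.
    apply: le_trans f4; rewrite le_eqVlt; apply/orP; left; apply/eqP.
    by apply: eq_bigr => x _; rewrite -[4%N]/(2 * 2)%N !exprM real_normK ?num_real.
  have f1 : dot_pi pi f f <= 1.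
    (* [2 f^2 <= 1 + f^4] *)
    rewrite -(ler_pM2l (ltr0n R 2)) mulr1.
    apply: le_trans (lerD (lexx 1) f4').
    rewrite -[X in X + _]pi_sum1 -big_split mulr_sumr; apply: ler_sum => x _ /=.
    rewrite -subr_ge0.
    have -> : pi x + f x ^+ 4 * pi x - 2 * (f x * f x * pi x)
      = (f x ^+ 2 - 1) ^+ 2 * pi x by ring.
    by rewrite mulr_ge0 ?sqr_ge0.
  have e : 1 = 2 * 2^-1 :> R by rewrite mulfV ?pnatr_eq0.
  rewrite [X in X / (_ * (1 - b) * _)]e.
  apply: (main _ _ _ _ sb01 K0 f1).
  apply: (bias_le p_trans p_irr pi_distr p_rev nu_distr b01 _ _ _ _).
  + exact: ler0n R 8%N.
  + by rewrite sqrtr_ge0.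
  + by move=> m; exact: (product_L2_of_L4 p_trans p_irr pi_distr p_rev b01 m f4').
  have s1 : 1 <= Num.sqrt 2 :> R by rewrite -[leLHS]sqrtr1 ler_sqrt // ler1n.
  have x0 : 0 <= b ^+ burn_in b C * Num.sqrt dev.
    by rewrite mulr_ge0 ?exprn_ge0 // ltW.
  exact: half_bound x0 s1 hC.
- have hC : b ^+ burn_in b C * C <= 1 by rewrite burn_in_le1 ?b01 ?mulr_ge0.
  have e : n%:R ^+ 2 * (1 - b) ^+ 2 = n%:R ^+ 2 * (1 - b) * (1 - b) :> R by ring.
  rewrite e; apply: worst_sq_error_le => [|f fsup]; first by apply: (boundE 1); rewrite ?mulr1.
  have fb x : `|f x| <= 1 := le_trans (sup_norm_ge f x) fsup.
  have f1 : dot_pi pi f f <= 1.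
    rewrite sqE -pi_sum1; apply: ler_sum => x _.
    by rewrite -[leRHS]mul1r ler_wpM2r // exprn_ile1.
  rewrite -[X in X / (_ * (1 - b) * _)]mulr1.
  apply: (main _ _ _ _ b01' ler01 f1).
  apply: (bias_le p_trans p_irr pi_distr p_rev nu_distr b01 _ _ _ _).
  + exact: ler0n R 2%N.
  + exact: ltW.
  + by move=> m; exact: (product_L2_of_bounded p_trans p_irr pi_distr p_rev m f1 fb).
  by rewrite [Num.sqrt _ * 2]mulrC.
Qed.
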